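(* Consider the final phase described in the context, in which the cartel is the sole producer after the fringe has depleted its resources. If $2b-k^c\le\alpha$, then for every $t$ such that $T^f\le t\le T^c$ in this phase, the optimal control $q^c_*(t)$ of the cartel is equal to $\frac{\alpha-b}{\beta}$, the price is $b$, and the depletion time of the cartel's resources is $\hat T^c=T^f+\frac{S_0^c\cdot\beta}{\alpha-b}$.
   Context: A nonrenewable resource market consists of a cartel and a fringe of many small firms. Constants: $\alpha,\beta>0$ are the parameters of the linear inverse demand, $r>0$ is the discount rate, $k^c$ and $k^f$ are the constant marginal extraction costs of the cartel and of the fringe, and $b>0$ is the marginal cost of a renewable perfect substitute, which bounds the resource price from above; $k^c<k^f<b<\alpha$. The initial stock of resources of the cartel (at time $0$) is $S_0^c$; the cartel's stock satisfies $\dot S^c(t)=-q^c(t)$, $S^c(0)=S_0^c$, $S^c(t)\ge 0$, where the measurable function $q^c$ is the cartel's extraction intensity, with values in $[0,M^c]$ for a large constant $M^c$. $T^f$ is the time when the fringe depletes its resources and $T^c$ is the time when the cartel depletes its resources. The phase considered starts at $T^f$ and ends at $T^c$ (a free terminal time, with $S^c(T^c)=0$); it occurs either after a phase of joint extraction by the cartel and the fringe firms, or after the fringe, as the sole extractor because the cartel was waiting, has depleted its resources. In this phase the fringe extracts nothing, the price is $p(t)=\alpha-\beta q^c(t)\in[0,b]$, so that $q^c(t)\in\left[\frac{\alpha-b}{\beta},\frac{\alpha}{\beta}\right]$, and the cartel maximizes its discounted net profit in the phase, $\int_{T^f}^{T^c}e^{-rt}\left(\alpha-\beta q^c(t)-k^c\right)q^c(t)\,dt$.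 Equality of controls is understood almost everywhere in $t$. The symbol $\hat T^c$ denotes the depletion time of the cartel resulting from the optimal control in this phase.
   Formalization: The depletion-time formula is proved with the cartel's stock at time T^f in place of the time-0 stock S_0^c, since the literal formula fails if the cartel extracted before T^f; it is proved with S_0^c when the cartel extracted nothing before T^f. *)

(* Defs.v *)
From HB Require Import structures.
From mathcomp Require Import all_boot all_order all_algebra.
From mathcomp Require Import all_classical all_reals all_analysis.

Set Implicit Arguments.
Unset Strict Implicit.
Unset Printing Implicit Defensive.

Import Order.TTheory GRing.Theory Num.Theory.
Import numFieldNormedType.Exports.
Local Open Scope classical_set_scope.
Local Open Scope ring_scope.

(* Solution at time t of S' = - q, S(t0) = S0, for a merely measurable
   bounded q, i.e. the (Caratheodory) integral form of the equation. *)
Definition stock {R : realType} (S0 t0 : R) (q : R -> R) (t : R) : R :=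
  S0 - \int[lebesgue_measure]_(s in `[t0, t]) q s.

Definition price {R : realType} (alpha beta : R) (q : R -> R) (t : R) : R :=
  alpha - beta * q t.

Definition extraction {R : realType} (M S0 t0 t1 : R) (q : R -> R) : Prop :=
  [/\ measurable_fun (`[t0, t1] : set R) q,
      forall t, t0 <= t <= t1 -> 0 <= q t <= M
    & forall t, t0 <= t <= t1 -> 0 <= stock S0 t0 q t].

Definition discounted_profit {R : realType} (alpha beta r k t0 t1 : R)
    (q : R -> R) : R :=
  \int[lebesgue_measure]_(t in `[t0, t1])
    (expR (- (r * t)) * (price alpha beta q t - k) * q t).

(* The terminal (depletion) time T is free, so a policy of the phase that
   starts at Tf with stock Sf is a pair (q, T). The profit is not integrated
   beyond T, and only the values of q on [Tf, T] matter. *)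
Definition admissible {R : realType} (alpha beta b M Sf Tf : R)
    (q : R -> R) (T : R) : Prop :=
  [/\ Tf <= T,
      extraction M Sf Tf T q,
      forall t, Tf <= t <= T -> 0 <= price alpha beta q t <= b
    & stock Sf Tf q T = 0].

Definition optimal {R : realType} (alpha beta r k b M Sf Tf : R)
    (q : R -> R) (T : R) : Prop :=
  admissible alpha beta b M Sf Tf q T /\
  forall (q' : R -> R) (T' : R), admissible alpha beta b M Sf Tf q' T' ->
    discounted_profit alpha beta r k Tf T' q' <=
    discounted_profit alpha beta r k Tf T q.

(* Main.v *)
Require Import Defs.
From HB Require Import structures.
From mathcomp Require Import all_boot all_order all_algebra.
From mathcomp Require Import all_classical all_reals all_analysis.
From mathcomp Require Import measurable_realfun ring lra.

Import Order.TTheory GRing.Theory Num.Theory.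
Import numFieldNormedType.Exports.
Local Open Scope classical_set_scope.
Local Open Scope ring_scope.

(** Exhaustion fixes the total extraction, but the length of the phase is free.
    Let [m = (alpha - b) / beta] be the smallest extraction intensity compatible
    with the price ceiling [b]; every admissible policy extracts at least [m] at
    every instant.

    The instantaneous profit [(alpha - beta x - k) x] is a concave parabola in
    [x], whose slope at [m] is [2 b - k - alpha].  The hypothesis
    [2 b - k <= alpha] says that this slope is nonpositive, so the profit rate
    is largest at [m] among all intensities [x >= m] ([profit_rate_le]).  On the
    other hand, a policy that extracts at least [m] at every instant out of a
    stock [S] lasts at most [S / m], which is the duration of the constant
    policy [m] ([depletion_time_le]).  The constant policy wins twice: it earns
    the largest profit rate, and it earns it for the longest time, which is a
    gain since this rate [(b - k) m] is positive.

    Uniqueness comes from the durations.  A policy of a strictly shorter phase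
    earns at most what [m] would earn on that phase
    ([discounted_profit_le_ceiling]), and so misses at least the positive profit
    of the remaining interval ([ceiling_profit_lt]).  Hence an optimal policy
    lasts exactly [S / m]; extracting at least [m] throughout and [S] in total,
    it equals [m] almost everywhere ([admissible_longest]). *)

(** * Integrals over a segment *)

Lemma integrable_itv_bounded {R : realType} {a b : R} (K : R) {f : R -> R} :
  measurable_fun (`[a, b] : set R) f ->
  (forall t, a <= t <= b -> `|f t| <= K) ->
  lebesgue_measure.-integrable `[a, b] (EFin \o f).
Proof.
move=> mf fK; apply: measurable_bounded_integrable => //.
  by rewrite /= lebesgue_measure_itv/=; case: ifPn => _; rewrite ltry.
exists K; split; first exact: num_real.
move=> x Kx t /=; rewrite in_itv/= => abt.
exact: le_trans (fK t abt) (ltW Kx).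
Qed.

Lemma Rintegral_itv_cst {R : realType} {a b : R} (c : R) : a <= b ->
  \int[lebesgue_measure]_(t in `[a, b]) c = c * (b - a).
Proof.
move=> ab; rewrite Rintegral_cst//= lebesgue_measure_itv/= lte_fin.
move: ab; rewrite le_eqVlt => /predU1P[->|->]; last by [].
by rewrite ltxx/= subrr.
Qed.

Lemma integrable_itv_cst {R : realType} (a b c : R) :
  lebesgue_measure.-integrable (`[a, b] : set R) (EFin \o (fun=> c)).
Proof. exact: (integrable_itv_bounded `|c|). Qed.

Lemma Rintegral_itv_ge {R : realType} {a b c : R} {f : R -> R} : a <= b ->
  lebesgue_measure.-integrable `[a, b] (EFin \o f) ->
  (forall t, a <= t <= b -> c <= f t) ->
  c * (b - a) <= \int[lebesgue_measure]_(t in `[a, b]) f t.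
Proof.
move=> ab intf cf; rewrite -Rintegral_itv_cst//.
by apply: le_Rintegral => //; exact: integrable_itv_cst.
Qed.

(** A lower bound [d > 0] on the added piece replaces mere positivity of [f],
    so that the strict inequality is a comparison with a constant. *)
Lemma Rintegral_itv_lt {R : realType} {a x y d : R} {f : R -> R} :
  a <= x -> x < y -> 0 < d ->
  lebesgue_measure.-integrable `[a, y] (EFin \o f) ->
  (forall t, x <= t <= y -> d <= f t) ->
  \int[lebesgue_measure]_(t in `[a, x]) f t <
  \int[lebesgue_measure]_(t in `[a, y]) f t.
Proof.
move=> ax xy d0 intf df; rewrite -subr_gt0.
have intxy : lebesgue_measure.-integrable `[x, y] (EFin \o f).
  by apply: integrableS intf => //; apply: subset_itvr; rewrite bnd_simp.
rewrite Rintegral_itvB ?bnd_simp// ?(ltW xy)//.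
rewrite Rintegral_itv_obnd_cbnd; last first.
  by apply: integrableS intxy => //; apply: subset_itvr; rewrite bnd_simp.
apply: lt_le_trans _ (Rintegral_itv_ge (ltW xy) intxy df).
by rewrite mulr_gt0// subr_gt0.
Qed.

(** The nonnegative function [f - c] has a vanishing integral. *)
Lemma ae_eq_cst_of_Rintegral {R : realType} {a b c : R} {f : R -> R} :
  a <= b ->
  lebesgue_measure.-integrable `[a, b] (EFin \o f) ->
  (forall t, a <= t <= b -> c <= f t) ->
  \int[lebesgue_measure]_(t in `[a, b]) f t = c * (b - a) ->
  {ae lebesgue_measure, forall t : R, a <= t <= b -> f t = c}.
Proof.
move=> ab intf cf If.
have intc := integrable_itv_cst a b c.
have intg : lebesgue_measure.-integrable (`[a, b] : set R)
    (EFin \o (fun t => f t - c)).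
  exact: (integrableB _ intf intc).
have [mg _] := integrableP _ _ _ intg.
have I0 : (\int[lebesgue_measure]_(t in `[a, b]) `|(f t - c)%:E| = 0)%E.
  under eq_integral => t.
    rewrite inE/= in_itv/= => /cf ct; rewrite ger0_norm ?subr_ge0//.
    over.
  rewrite -[LHS]fineK; last exact: integrable_fin_num.
  congr EFin; have := RintegralB _ intf intc; rewrite /Rintegral => -> //.
  by have := If; have := Rintegral_itv_cst c ab; rewrite /Rintegral => -> ->;
    rewrite subrr.
move: (ae_eq_integral_abs lebesgue_measure (measurable_itv `[a, b]) mg)
  => [+ _] => /(_ I0).
apply: filterS => t + abt; rewrite /= in_itv/= => /(_ abt)-[] /eqP.
by rewrite subr_eq0 => /eqP.
Qed.

(** * Consequences of the price ceiling at one instant *)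

Lemma intensity_ge {R : realType} {alpha beta b x : R} : 0 < beta ->
  alpha - beta * x <= b -> (alpha - b) / beta <= x.
Proof. by move=> beta0 xb; rewrite ler_pdivrMr//; lra. Qed.

(** With [m = (alpha - b) / beta], the difference of the two sides is
    [(x - m) (beta x - (b - k))], and [beta x >= beta m = alpha - b >= b - k]. *)
Lemma profit_rate_le {R : realType} (alpha beta b k x : R) : 0 < beta ->
  2 * b - k <= alpha -> alpha - beta * x <= b ->
  (alpha - beta * x - k) * x <= (b - k) * ((alpha - b) / beta).
Proof.
move=> beta0 hb xb; have := intensity_ge beta0 xb.
have : beta * ((alpha - b) / beta) = alpha - b.
  by rewrite mulrCA divff ?mulr1// gt_eqF.
move: ((alpha - b) / beta) => m mE mx; rewrite -subr_ge0.
have -> : (b - k) * m - (alpha - beta * x - k) * x =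
    (x - m) * (beta * x - (b - k)).
  by have -> : alpha = b + beta * m by [rewrite mE addrC subrK]; ring.
by rewrite mulr_ge0 ?subr_ge0//; lra.
Qed.

(** * Extraction and stock *)

Lemma extraction_integrable {R : realType} {M S0 t0 t1 : R} {q : R -> R} :
  extraction M S0 t0 t1 q ->
  lebesgue_measure.-integrable `[t0, t1] (EFin \o q).
Proof.
move=> [mq qM _]; apply: (integrable_itv_bounded M) => // t /qM /andP[q0 qM'].
by rewrite ger0_norm.
Qed.

Lemma stock_ae0 {R : realType} {M S0 t0 t1 : R} {q : R -> R} :
  extraction M S0 t0 t1 q ->
  {ae lebesgue_measure, forall t : R, t0 <= t <= t1 -> q t = 0} ->
  stock S0 t0 q t1 = S0.
Proof.
move=> ext q0; rewrite /stock /Rintegral.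
rewrite (ae_eq_integral (cst 0%E))//.
- by rewrite integral0 subr0.
- by have [] := integrableP _ _ _ (extraction_integrable ext).
- move: q0; apply: filterS;
    first exact: (ae_filter_ringOfSetsType lebesgue_measure).
  by move=> t q0t; rewrite /= in_itv/= => /q0t ->.
Qed.

(** * Policies of a sole producer with a free depletion time *)

Section phase.
Context {R : realType} {alpha beta r k b M S Tf : R}.
Hypotheses (beta_gt0 : 0 < beta) (r_gt0 : 0 < r).
Hypotheses (k_lt_b : k < b) (b_lt_alpha : b < alpha).

Let m := (alpha - b) / beta.
Let Tmax := Tf + S * beta / (alpha - b).

Let m_gt0 : 0 < m.
Proof. by rewrite divr_gt0// subr_gt0. Qed.

Let m_Tmax : m * (Tmax - Tf) = S.
Proof.
rewrite /m /Tmax; field.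
by rewrite gt_eqF ?subr_gt0// gt_eqF.
Qed.

Let admissible_ge_m {q T} : admissible alpha beta b M S Tf q T ->
  forall t, Tf <= t <= T -> m <= q t.
Proof. by move=> [_ _ pb _] t /pb /andP[_]; exact: intensity_ge. Qed.

Let discount_ge t T : t <= T -> expR (- (r * T)) <= expR (- (r * t)).
Proof. by move=> tT; rewrite ler_expR lerN2 ler_pM2l. Qed.

Let measurable_discount (D : set R) :
  measurable_fun D (fun t => expR (- (r * t))).
Proof.
apply: (measurableT_comp (f := expR)) => //.
by apply: measurableT_comp => //; exact: measurable_funM.
Qed.

Let integrable_discount (c a y : R) :
  lebesgue_measure.-integrable (`[a, y] : set R)
    (EFin \o (fun t => expR (- (r * t)) * c)).
Proof.
apply: (integrable_itv_bounded (expR (- (r * a)) * `|c|)).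
  exact: measurable_funM.
move=> t /andP[at_ _]; rewrite normrM ler_wpM2r//.
by rewrite ger0_norm ?expR_ge0// discount_ge.
Qed.

Lemma integrable_discounted_profit {q T} :
  admissible alpha beta b M S Tf q T ->
  lebesgue_measure.-integrable `[Tf, T] (EFin \o
    (fun t => expR (- (r * t)) * (price alpha beta q t - k) * q t)).
Proof.
move=> [TfT [mq qM _] pb _].
apply: (integrable_itv_bounded (expR (- (r * Tf)) * (b + `|k|) * M)).
  apply: measurable_funM => //; apply: measurable_funM => //.
  apply: measurable_funB => //; apply: measurable_funB => //.
  exact: measurable_funM.
move=> t tT; have /andP[q0 qM'] := qM _ tT; have /andP[p0 pb'] := pb _ tT.
have /andP[Tft _] := tT.
rewrite !normrM ler_pM// ?mulr_ge0//; last by rewrite ger0_norm.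
rewrite ler_pM//; first by rewrite ger0_norm ?expR_ge0// discount_ge.
by apply: le_trans (ler_normB _ _) _; rewrite lerD2r ger0_norm.
Qed.

(** The total extraction [S] is at least [m * (T - Tf)]. *)
Lemma depletion_time_le {q T} :
  admissible alpha beta b M S Tf q T -> T <= Tmax.
Proof.
move=> adm; have [TfT ext _ S0] := adm.
have := Rintegral_itv_ge TfT (extraction_integrable ext) (admissible_ge_m adm).
move/eqP: S0; rewrite /stock subr_eq0 => /eqP <-.
by rewrite -m_Tmax ler_pM2l// lerD2r.
Qed.

(** The discounted profit of extracting [m] from [Tf] until [T], whether or not
    [T] exhausts the stock: the common scale on which policies of different
    durations are compared. *)
Let ceiling_profit T :=
  \int[lebesgue_measure]_(t in `[Tf, T]) (expR (- (r * t)) * ((b - k) * m)).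

Lemma discounted_profit_ceiling T :
  discounted_profit alpha beta r k Tf T (fun=> m) = ceiling_profit T.
Proof.
rewrite /discounted_profit /ceiling_profit; apply: eq_Rintegral => t _.
rewrite -mulrA; congr (_ * (_ * _)); rewrite /price /m.
by field; rewrite gt_eqF.
Qed.

Lemma ceiling_profit_lt {T T'} : Tf <= T -> T < T' ->
  ceiling_profit T < ceiling_profit T'.
Proof.
move=> TfT TT'.
apply: (@Rintegral_itv_lt _ _ _ _ (expR (- (r * T')) * ((b - k) * m))) => //.
  by rewrite mulr_gt0 ?expR_gt0// mulr_gt0// subr_gt0.
move=> t /andP[_ tT']; rewrite ler_wpM2r ?discount_ge//.
by rewrite mulr_ge0 ?subr_ge0// ltW.
Qed.

Lemma discounted_profit_le_ceiling {q T} : 2 * b - k <= alpha ->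
  admissible alpha beta b M S Tf q T ->
  discounted_profit alpha beta r k Tf T q <= ceiling_profit T.
Proof.
move=> hb adm; apply: le_Rintegral => //.
  exact: integrable_discounted_profit adm.
have [_ _ pb _] := adm.
move=> t /=; rewrite in_itv/= => /pb /andP[_ ptb].
rewrite -mulrA ler_wpM2l ?expR_ge0//.
exact: profit_rate_le.
Qed.

Lemma admissible_ceiling : 0 <= b -> 0 <= S -> alpha / beta <= M ->
  admissible alpha beta b M S Tf (fun=> m) Tmax.
Proof.
move=> b0 S0 alphaM.
have pE t : price alpha beta (fun=> m) t = b.
  by rewrite /price /m; field; rewrite gt_eqF.
have stE t : Tf <= t -> stock S Tf (fun=> m) t = S - m * (t - Tf).
  by move=> Tft; rewrite /stock Rintegral_itv_cst.
have TfT : Tf <= Tmax.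
  by rewrite /Tmax lerDl divr_ge0 ?mulr_ge0 ?subr_ge0// ltW.
split => //.
- split => //.
  + move=> t _; rewrite (ltW m_gt0)/=; apply: le_trans alphaM.
    by rewrite /m ler_pM2r ?invr_gt0//; lra.
  + move=> t /andP[Tft tT]; rewrite stE// subr_ge0 -[leRHS]m_Tmax.
    by rewrite ler_pM2l// lerD2r.
- by move=> t _; rewrite pE b0/=.
- by rewrite stE// m_Tmax subrr.
Qed.

Lemma optimal_ceiling : 0 <= b -> 0 <= S -> alpha / beta <= M ->
  2 * b - k <= alpha -> optimal alpha beta r k b M S Tf (fun=> m) Tmax.
Proof.
move=> b0 S0 alphaM hb; split; first exact: admissible_ceiling.
move=> q T adm; rewrite discounted_profit_ceiling.
apply: le_trans (discounted_profit_le_ceiling hb adm) _.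
have [TfT _ _ _] := adm.
have := depletion_time_le adm; rewrite le_eqVlt => /predU1P[->//|TT].
exact/ltW/ceiling_profit_lt.
Qed.

Lemma optimal_depletion_time {q T} : 0 <= b -> 0 <= S -> alpha / beta <= M ->
  2 * b - k <= alpha -> optimal alpha beta r k b M S Tf q T -> T = Tmax.
Proof.
move=> b0 S0 alphaM hb [adm opt].
have := opt _ _ (admissible_ceiling b0 S0 alphaM).
rewrite discounted_profit_ceiling => Popt.
have [TfT _ _ _] := adm.
have := depletion_time_le adm; rewrite le_eqVlt => /predU1P[//|TT].
have := le_lt_trans (discounted_profit_le_ceiling hb adm)
  (ceiling_profit_lt TfT TT).
by rewrite ltNge Popt.
Qed.

Lemma admissible_longest {q} : admissible alpha beta b M S Tf q Tmax ->
  {ae lebesgue_measure, forall t : R, Tf <= t <= Tmax -> q t = m}.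
Proof.
move=> adm; have [TfT ext _ S0] := adm.
apply: (ae_eq_cst_of_Rintegral TfT (extraction_integrable ext)).
  exact: admissible_ge_m adm.
by move/eqP: S0; rewrite m_Tmax /stock subr_eq0 => /eqP <-.
Qed.

End phase.

(* MathComp-Analysis. qpre is the cartel's extraction before the phase, so
   stock S0 0 qpre Tf is its stock at the beginning Tf of the phase. *)
Theorem proposition3 (R : realType) (alpha beta r b kc kf M S0 Tf : R)
    (qpre : R -> R)
    (alpha_gt0 : 0 < alpha) (beta_gt0 : 0 < beta) (r_gt0 : 0 < r)
    (b_gt0 : 0 < b)
    (kc_lt_kf : kc < kf) (kf_lt_b : kf < b) (b_lt_alpha : b < alpha)
    (M_large : alpha / beta <= M)
    (Tf_ge0 : 0 <= Tf)
    (qpre_extraction : extraction M S0 0 Tf qpre)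
    (hb : 2 * b - kc <= alpha) :
  let Sf := stock S0 0 qpre Tf in
  optimal alpha beta r kc b M Sf Tf
    (fun=> (alpha - b) / beta) (Tf + Sf * beta / (alpha - b)) /\
  forall (q : R -> R) (T : R), optimal alpha beta r kc b M Sf Tf q T ->
    [/\ {ae lebesgue_measure, forall t : R,
          Tf <= t <= T -> q t = (alpha - b) / beta},
        {ae lebesgue_measure, forall t : R,
          Tf <= t <= T -> price alpha beta q t = b},
        T = Tf + Sf * beta / (alpha - b)
      & {ae lebesgue_measure, forall t : R, 0 <= t <= Tf -> qpre t = 0} ->
        T = Tf + S0 * beta / (alpha - b)].
Proof.
move=> Sf.
have kc_lt_b : kc < b := lt_trans kc_lt_kf kf_lt_b.
have Sf_ge0 : 0 <= Sf.
  by have [_ _] := qpre_extraction; apply; rewrite Tf_ge0 lexx.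
split; first by apply: optimal_ceiling => //; exact: ltW.
move=> q T opt.
have TE : T = Tf + Sf * beta / (alpha - b).
  exact: (optimal_depletion_time beta_gt0 r_gt0 kc_lt_b b_lt_alpha
    (ltW b_gt0) Sf_ge0 M_large hb opt).
have qE : {ae lebesgue_measure, forall t : R,
    Tf <= t <= T -> q t = (alpha - b) / beta}.
  have [adm _] := opt; move: adm; rewrite TE => adm.
  exact: admissible_longest adm.
split => //.
- move: qE; apply: filterS;
    first exact: (ae_filter_ringOfSetsType lebesgue_measure).
  move=> t qt /qt; rewrite /price => ->.
  by field; rewrite gt_eqF.
- by move=> /(stock_ae0 qpre_extraction) <-.
Qed.
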